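(* Let $|\psi\rangle$ be the PEPS associated to a classical spin model with nearest-neighbour interaction on a square lattice. Assume the generic conditions that the matrices $\phi^e$ are invertible and that $C(x)\neq0$ for all configurations $x$ (both hold, e.g., for the Ising model). Then, although $|\psi\rangle$ does not have the injectivity property, it is still the unique ground state of its parent Hamiltonian. Moreover, let $R_1$ be a $3\times3$ block of sites and let $R_2\subset R_1$ be the cross consisting of the central site of $R_1$ and its four nearest neighbours. Then $P_{R_1}=P_{R_2}\otimes\mathbb{1}$, where $P_R$ denotes the projection onto the orthogonal complement of $G_R$; hence the local interaction term of the parent Hamiltonian can be taken to be either $P_{R_1}$ or $P_{R_2}$.
   Context: A PEPS on a graph is given by assigning to each vertex $v$ tensors $A^{(v)}_i$, $i=1,\dots,d$, with one $D$-valued index for each edge at $v$; the state is $\sum_{i_1,i_2,\dots}\mathcal{C}[\{A^{(v)}_{i_v}\}_v]\,|i_1,i_2,\dots\rangle$, where $\mathcal{C}$ denotes contraction of the tensors along the edges of the graph. Classical model: energy $H_{cl}(x)=\sum_{(i,j)}h(x_i,x_j)$, $x_i=1,\dots,d$, the sum running over the edges of the interaction graph (here the square lattice), at a fixed inverse temperature $\beta$. The associated PEPS is $|\psi\rangle=\frac{1}{\sqrt Z}\sum_xe^{-\frac\beta2H_{cl}(x)}|x\rangle$. For each edge $(i,j)$ one chooses vectors $|\phi^i_{x}\rangle,|\phi^j_{x}\rangle\in\mathbb{C}^d$ with $\exp[-\frac\beta2h(x_i,x_j)]=\sum_k\langle\phi^i_{x_i}|k\rangle\langle k|\phi^j_{x_j}\rangle$.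 With $\phi^e_{x_i}$ denoting the vector belonging to the edge $e$ at site $i$, the PEPS tensors (with $D=d$, up to normalization) are $A^i_{x_i;\alpha_1\dots\alpha_n}=\prod_e\langle\phi^e_{x_i}|\alpha_e\rangle$, $\alpha_e=1,\dots,d$, the product being over all edges $e$ at site $i$ (the vectors may depend on the site). $\phi^e$ is regarded as a $d\times d$ matrix via $\langle x_i|\mapsto\langle\phi^e_{x_i}|$. For a region (set of sites) $R$ with $e_R$ edges connecting it to its exterior, let $A_{i_R}$ be the tensor obtained by contracting all tensors in $R$ along the edges inside $R$, leaving the $e_R$ boundary indices open. Define $\Gamma_R:\mathbb{C}^{D^{e_R}}\to\mathbb{C}^{d^{|R|}}$ by $\Gamma_R(C)=\sum_{i_R}\mathcal{C}[A_{i_R}C]\,|i_R\rangle$, and $G_R=\mathrm{range}(\Gamma_R)$. For a configuration $x$ on $R$, $C(x)$ denotes the scalar factor of the matrix element $\langle x|\Gamma_R|\bar\alpha\rangle$ resulting from the contractions along all edges inside $R$. A connected region $R$ is injective if $\Gamma_R$ is injective; a PEPS is injective if there is a proper covering of the graph by disjoint injective regions. A parent Hamiltonian is a sum of local terms $h_v\otimes\mathbb{1}$ over the lattice, where $h_v\ge0$ acts on a region $R_v$ surrounding the vertex $v$ and $\ker(h_v)=G_{R_v}$; here the regions $R_v$ are $3\times3$ blocks (or crosses).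
   Formalization: Non-injectivity is for coverings whose regions each miss a row and a column (full-width strips are injective); the projector identity is for blocks off open boundaries; d≥2, sides ≥3 (≥4 if periodic); target-end vectors conjugated in the tensors; the Ising example is omitted. *)

(* Defs.v *)
From mathcomp Require Import all_boot all_order all_algebra.
From mathcomp Require Import complex.
From mathcomp Require Import reals sequences exp.

Set Implicit Arguments.
Unset Strict Implicit.
Unset Printing Implicit Defensive.
Import Order.TTheory GRing.Theory Num.Theory.
Local Open Scope ring_scope.

(* [lab S k]: functions S -> {1,...,k}. It serves both for spin configurations *)
(* on a region S and for values of the virtual indices on a set S of edges.    *)
Definition lab (T : finType) (S : {set T}) (k : nat) : finType :=
  {ffun {t : T | t \in S} -> 'I_k}.

Definition res (T : finType) (S S' : {set T}) (k : nat) (sub : S \subset S')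
    (f : lab S' k) : lab S k :=
  [ffun s : {t : T | t \in S} =>
     f (exist _ (sval s) (subsetP sub (sval s) (svalP s)))].

(* The Hilbert space with orthonormal basis |x>, x : X, is 'rV[K]_#|X|.        *)
(* Following the row-vector convention of mxalgebra, operators act on the      *)
(* right: a matrix M stands for the operator u |-> u *m M, and its (x, y)      *)
(* entry is the matrix element <y|M|x>.                                        *)
Definition ket (K : Type) (X : finType) (f : X -> K) : 'rV[K]_#|X| :=
  \row_k f (enum_val k).

Definition fin_mx (K : Type) (X Y : finType) (F : X -> Y -> K) :
    'M[K]_(#|X|, #|Y|) :=
  \matrix_(i, j) F (enum_val i) (enum_val j).

Section Operators.
Variable K : numClosedFieldType.

(* M (x) 1 on the region R, for an operator M on the sub-region S. *)
Definition tensor_id (V : finType) (d : nat) (S R : {set V})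
    (sub : S \subset R) (M : 'M[K]_#|lab S d|) : 'M[K]_#|lab R d| :=
  fin_mx (fun x y : lab R d =>
    if res (subsetDl R S) x == res (subsetDl R S) y
    then M (enum_rank (res sub x)) (enum_rank (res sub y)) else 0).

Definition psdmx (n : nat) (M : 'M[K]_n) : Prop :=
  M \is hermsymmx /\ forall u : 'rV[K]_n, 0 <= dotmx (u *m M) u.

Definition ground_state (n : nat) (H : 'M[K]_n) (u : 'rV[K]_n) : Prop :=
  u != 0 /\
  exists E0 : K, u *m H = E0 *: u /\ forall E, eigenvalue H E -> E0 <= E.

Definition unique_ground_state (n : nat) (H : 'M[K]_n) (u : 'rV[K]_n) : Prop :=
  ground_state H u /\
  forall w, ground_state H w -> exists c : K, w = c *: u.

End Operators.

(* A finite simple graph is given by a set E of pairs containing every edge in *)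
(* exactly one of its two orientations.                                        *)
Section Graph.
Variables (V : finType) (E : {set V * V}).

Definition adj (u v : V) : bool := ((u, v) \in E) || ((v, u) \in E).

Definition incident (v : V) : {set V * V} :=
  [set e in E | (e.1 == v) || (e.2 == v)].
Definition touching (R : {set V}) : {set V * V} :=
  [set e in E | (e.1 \in R) || (e.2 \in R)].
Definition inner (R : {set V}) : {set V * V} :=
  [set e in E | (e.1 \in R) && (e.2 \in R)].
Definition boundary (R : {set V}) : {set V * V} :=
  [set e in E | (e.1 \in R) (+) (e.2 \in R)].

Lemma incident_touching (R : {set V}) (v : {v : V | v \in R}) :
  incident (sval v) \subset touching R.
Proof.
apply/subsetP => e; rewrite !inE => /andP[-> /orP[/eqP -> | /eqP ->]];
  by rewrite (svalP v) ?orbT.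
Qed.

Lemma boundary_touching (R : {set V}) : boundary R \subset touching R.
Proof.
by apply/subsetP => e; rewrite !inE => /andP[->]; case: (e.1 \in R).
Qed.

Lemma inner_src (R : {set V}) (e : V * V) : e \in inner R -> e.1 \in R.
Proof. by rewrite inE => /and3P[]. Qed.

Lemma inner_tgt (R : {set V}) (e : V * V) : e \in inner R -> e.2 \in R.
Proof. by rewrite inE => /and3P[]. Qed.

Definition connected_region (R : {set V}) : Prop :=
  R != set0 /\
  {in R &, forall u v, connect [rel a b | [&& a \in R, b \in R & adj a b]] u v}.

End Graph.

Section Peps.
Variables (K : numClosedFieldType) (V : finType) (E : {set V * V}) (d D : nat).
Variable A : forall v : V, 'I_d -> lab (incident E v) D -> K.

(* The tensor A_{i_R}: all tensors of R are multiplied and the indices of the  *)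
(* inner edges are summed over, those of the boundary edges being fixed.       *)
Definition contract (R : {set V}) (alpha : lab (boundary E R) D)
    (x : lab R d) : K :=
  \sum_(g : lab (touching E R) D | res (boundary_touching E R) g == alpha)
    \prod_(v : {v : V | v \in R})
      A (x v) (res (incident_touching E v) g).

Definition Gamma (R : {set V}) : 'M[K]_(#|lab (boundary E R) D|, #|lab R d|) :=
  fin_mx (@contract R).

Definition G (R : {set V}) : 'M[K]_#|lab R d| := <<Gamma R>>%MS.

Definition injective_region (R : {set V}) : Prop :=
  connected_region E R /\
  injective (fun u : 'rV[K]_#|lab (boundary E R) D| => u *m Gamma R).

Definition injective_peps (proper_covering : {set {set V}} -> Prop) : Prop :=
  exists cov : {set {set V}},
    [/\ partition cov [set: V], proper_covering cov &
        forall R, R \in cov -> injective_region R].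

(* The orthogonal projection onto the orthogonal complement of G_R. *)
Definition P (R : {set V}) : 'M[K]_#|lab R d| :=
  proj_ortho (orthomx Num.conj (mx_of_hermitian (hermitian1mx _)) (G R)).

Definition sum_local (Rv : V -> {set V}) (h : forall v, 'M[K]_#|lab (Rv v) d|) :
    'M[K]_#|lab [set: V] d| :=
  \sum_(v : V) tensor_id (subsetT (Rv v)) (h v).

Definition parent_term (R : {set V}) (h : 'M[K]_#|lab R d|) : Prop :=
  psdmx h /\ (kermx h == G R)%MS.

Definition parent_hamiltonian (Rv : V -> {set V})
    (H : 'M[K]_#|lab [set: V] d|) : Prop :=
  exists h : forall v, 'M[K]_#|lab (Rv v) d|,
    (forall v, parent_term (h v)) /\ H = sum_local h.

End Peps.

Section Classical.
Variables (R : realType) (V : finType) (E : {set V * V}) (d : nat).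
Variables (h : 'I_d -> 'I_d -> R) (beta : R).

(* h need not be symmetric: on an edge its first argument is the spin at the   *)
(* source in the orientation recorded by E.                                    *)
Definition Hcl (x : lab [set: V] d) : R :=
  \sum_(e in E) h (x (exist _ e.1 (in_setT e.1))) (x (exist _ e.2 (in_setT e.2))).

Definition partition_function : R :=
  \sum_(x : lab [set: V] d) expR (- (beta * Hcl x)).

Definition classical_state : 'rV[R[i]]_#|lab [set: V] d| :=
  ket (fun x : lab [set: V] d =>
    (expR (- (beta / 2 * Hcl x)) / Num.sqrt partition_function)%:C%C).

(* phi e v is the matrix of the bras at the end v of the edge e:               *)
(* phi e v x k = <phi^{e,v}_x | k>.                                            *)
Variable phi : V * V -> V -> 'M[R[i]]_d.

Definition edge_amplitude (e : V * V) (x y : 'I_d) : R[i] :=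
  \sum_(k < d) phi e e.1 x k * Num.conj (phi e e.2 y k).

Definition boltzmann_decomposition : Prop :=
  forall e, e \in E -> forall x y : 'I_d,
    (expR (- (beta / 2 * h x y)))%:C%C = edge_amplitude e x y.

(* In the decomposition the target vector occurs as a ket, <k|phi_y>, so the   *)
(* tensor at the target of an edge carries the complex conjugate of the bra    *)
(* component; only then does contracting the edge give back the Boltzmann      *)
(* weight when phi is complex.                                                 *)
Definition site_amplitude (e : V * V) (v : V) (x k : 'I_d) : R[i] :=
  if v == e.1 then phi e v x k else Num.conj (phi e v x k).

Definition classical_tensor (v : V) (x : 'I_d) (alpha : lab (incident E v) d) :
    R[i] :=
  \prod_(e : {e : V * V | e \in incident E v})
    site_amplitude (sval e) v x (alpha e).

(* The factor C(x) of <x|Gamma_R|alpha> coming from the edges inside S. *)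
Definition inner_factor (S : {set V}) (x : lab S d) : R[i] :=
  \prod_(e : {e : V * V | e \in inner E S})
    edge_amplitude (sval e)
      (x (exist _ (sval e).1 (inner_src (svalP e))))
      (x (exist _ (sval e).2 (inner_tgt (svalP e)))).

End Classical.

Arguments classical_tensor {R V} E {d} phi v x alpha.

(* The m x n square lattice; px, py tell whether the boundary conditions are   *)
(* periodic (true) or open (false) in each of the two directions.              *)
Section Lattice.
Variables (px py : bool) (m n : nat).

Definition succ_ord (p : bool) (L : nat) (i j : 'I_L) : bool :=
  ((j : nat) == i.+1) || [&& p, (i : nat) == L.-1 & (j : nat) == 0%N].

Definition near (p : bool) (L : nat) (i j : 'I_L) : bool :=
  [|| i == j, succ_ord p i j | succ_ord p j i].

Definition site : finType := ('I_m * 'I_n)%type.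

Definition lattice : {set site * site} :=
  [set e | (succ_ord px e.1.1 e.2.1 && (e.1.2 == e.2.2))
        || ((e.1.1 == e.2.1) && succ_ord py e.1.2 e.2.2)].

(* At an open boundary blocks and crosses are truncated to the lattice. *)
Definition block (v : site) : {set site} :=
  [set w | near px v.1 w.1 && near py v.2 w.2].

Definition cross (v : site) : {set site} :=
  [set w | (w == v) || adj lattice v w].

Lemma cross_block (v : site) : cross v \subset block v.
Proof.
apply/subsetP => w; rewrite !inE /near => /orP[/eqP -> | ].
  by rewrite !eqxx.
rewrite /adj !inE /= => /orP[] /orP[] /andP[].
- by move=> -> ->; rewrite !orbT.
- by move=> -> ->; rewrite !orbT.
- by move=> -> /eqP ->; rewrite eqxx !orbT.
- by move=> /eqP -> ->; rewrite eqxx !orbT.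
Qed.

(* The block around v does not touch an open boundary: all of its sites have   *)
(* four neighbours. With periodic boundary conditions this always holds.       *)
Definition bulk (v : site) : Prop :=
  forall w, w \in block v -> #|[set u | adj lattice w u]| = 4%N.

(* A covering is proper if its regions are local, i.e. none of them stretches  *)
(* across the whole lattice in either direction. This has to be required: the  *)
(* whole lattice has no boundary edges, and in a strip of width > 1 every      *)
(* boundary site has a single one, so Gamma is injective on such regions.      *)
Definition proper_covering (cov : {set {set site}}) : Prop :=
  forall S, S \in cov ->
    (exists i : 'I_m, forall v, v \in S -> v.1 != i) /\
    (exists j : 'I_n, forall v, v \in S -> v.2 != j).

End Lattice.

(* Main.v *)
Require Import Defs.
From mathcomp Require Import all_boot all_order all_algebra.
From mathcomp Require Import complex.
From mathcomp Require Import reals sequences exp.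
From mathcomp Require Import ring zify.

Set Implicit Arguments.
Unset Strict Implicit.
Unset Printing Implicit Defensive.
Import Order.TTheory GRing.Theory Num.Theory.
Local Open Scope ring_scope.
Local Open Scope sesquilinear_scope.

(* Contracting the inner edges of S gives                                      *)
(*   <x|Gamma_S|alpha> = C(x) prod_e M_e(x_{v_e}, alpha_e),                    *)
(* e running over the boundary edges, v_e being the end of e in S and M_e an   *)
(* invertible matrix. Hence G_S is the space of vectors C(x) f(x), where f     *)
(* depends only on the spins at the sites with a boundary edge. A region       *)
(* missing a row and a column has a site with two boundary edges e, e';        *)
(* prescribing different spins on e and e' gives a nonzero vector killed by    *)
(* Gamma_S. If w is annihilated by every term of the parent Hamiltonian, then  *)
(* w/psi does not depend on the spin at v, for each v, since all neighbours of *)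
(* v are in R_v; so w/psi is constant. Finally, for a bulk block as for the    *)
(* cross inside it, the only site without a boundary edge is the centre, and   *)
(* both kernels say that w/C is independent of the central spin.               *)

(** * Hermitian matrices *)

(** Everything reduces to pointwise ratios with C, which never vanishes. By [contract_classical] and
    [mem_GP], a vector u lies in G_S exactly when u/C takes equal values on configurations with the
    same spins at the inner ends of the boundary edges. For S inside T, the quotient of the two
    factors C sees only these spins of S and the spins outside S ([inner_factor_ratio]), so
    membership can be tested on slices: [slice_sub_G] passes to the slices, [eq_off_site_G] comes
    back from them. The state is a multiple of C on the whole lattice, hence killed by all terms,
    which are positive semidefinite; ground states are therefore the vectors killed by each term
    ([psdmx_dot_eq0]), and [unique_ground_state_parent] compares them with C one site at a time.
    [P_tensor_id] identifies two orthogonal projections by their kernels ([hermsym_idem_inj]).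
    [not_injective_region] exploits a site with two boundary edges. The geometry of the lattice
    enters through [two_exits] and [block_exit]. *)

Section LinearAlgebra.
Variable K : numClosedFieldType.

Local Notation "B ^!" :=
  (orthomx Num.conj (mx_of_hermitian (hermitian1mx _)) B).

Lemma hermsymmxP n (M : 'M[K]_n) : reflect (M = M^t*) (M \is hermsymmx).
Proof.
by apply: (iffP (is_hermitianmxP _ _ _)); rewrite expr0 scale1r.
Qed.

Lemma adjmxM m n p (A : 'M[K]_(m, n)) (B : 'M_(n, p)) :
  (A *m B)^t* = B^t* *m A^t*.
Proof. by rewrite trmx_mul map_mxM. Qed.

Lemma adjmxK m n (A : 'M[K]_(m, n)) : A^t*^t* = A.
Proof. by apply/matrixP => i j; rewrite !mxE conjCK. Qed.

Lemma dotmx_sum n (u v : 'rV[K]_n) :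
  dotmx u v = \sum_k u 0 k * Num.conj (v 0 k).
Proof. by rewrite dotmxE mxE; apply: eq_bigr => k _; rewrite !mxE. Qed.

Lemma dotmx_ge0 n (u : 'rV[K]_n) : 0 <= dotmx u u.
Proof. by rewrite dotmx_sum; apply: sumr_ge0 => k _; rewrite mul_conjC_ge0. Qed.

Lemma dotmx_gt0 n (u : 'rV[K]_n) : u != 0 -> 0 < dotmx u u.
Proof. exact: dotmx_is_dotmx. Qed.

Lemma dotmx_mulr_hermsym n (M : 'M[K]_n) (u v : 'rV_n) :
  M \is hermsymmx -> dotmx (u *m M) v = dotmx u (v *m M).
Proof.
by move=> /hermsymmxP MH; rewrite !dotmxE adjmxM -MH mulmxA.
Qed.

(* Minimising <(u - t w)M, u - t w> over real t, for w = uM. *)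
Lemma psdmx_dot_eq0 n (M : 'M[K]_n) (u : 'rV_n) :
  psdmx M -> dotmx (u *m M) u = 0 -> u *m M = 0.
Proof.
move=> [MH Mge0] uM0; apply/eqP/negPn/negP => uMn0.
set w := u *m M in uMn0 *; set a := dotmx w w; set b := dotmx (w *m M) w.
have a0 : 0 < a by exact: dotmx_gt0.
have b0 : 0 <= b by exact: Mge0.
have c0 : 0 < b + 1 by rewrite ltr_wpDl.
pose t := a / (b + 1).
have tr : Num.conj t = t by apply/CrealP/ger0_real/divr_ge0; apply: ltW.
have tb : t * b <= a.
  rewrite /t mulrAC ler_pdivrMr // ler_pM2l // ler_wpDr //.
have := Mge0 (u - t *: w).
have -> : dotmx ((u - t *: w) *m M) (u - t *: w) =
   dotmx w u - t * dotmx w w - t * dotmx (w *m M) u + t * t * b.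
  rewrite mulmxBl -scalemxAl -/w /b !dotmx_sum !mulr_sumr -!sumrN -!big_split /=.
  by apply: eq_bigr => k _; rewrite !mxE rmorphB rmorphM /= tr; ring.
rewrite uM0 (dotmx_mulr_hermsym _ _ MH) -/w -/a.
have -> : 0 - t * a - t * a + t * t * b = t * (t * b - a - a) by ring.
rewrite pmulr_rge0 ?divr_gt0 // subr_ge0 => /(lt_le_trans a0).
by rewrite subr_gt0 => /(le_lt_trans tb); rewrite ltxx.
Qed.

(** The rows of Q lie in U and those of 1 - Q in its complement, so the adjoint of Q equals Q times
    its adjoint, which is self-adjoint. *)
Lemma proj_ortho_hermsym m n (U : 'M[K]_(m, n)) : proj_ortho U \is hermsymmx.
Proof.
set Q := proj_ortho U.
have QU : (Q <= U)%MS by rewrite -[Q]mul1mx proj_ortho_sub.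
have /orthomx1P : (1%:M - Q <= Q^!)%MS.
  apply: (submx_trans (_ : _ <= U^!)%MS).
    by rewrite -{1}[Q]mul1mx proj_ortho_compl_sub.
  by rewrite submx_ortho.
rewrite mulmxBl mul1mx => /eqP; rewrite subr_eq0 => /eqP e.
by apply/hermsymmxP; rewrite -[LHS]adjmxK e adjmxM adjmxK -e.
Qed.

Lemma kermx_proj_ortho_orthomx m n p (U : 'M[K]_(m, n)) (W : 'M_(p, n)) :
  (W *m proj_ortho U^! == 0) = (W <= U)%MS.
Proof.
apply/eqP/idP => [W0 | WU]; last by apply: proj_ortho_0; rewrite ortho_id.
by have := proj_ortho_compl_sub U^! W; rewrite W0 subr0 ortho_id.
Qed.

(** The rows of 1 - P1 lie in the kernel of P1, hence in that of P2, so P2 = P1 P2; symmetrically P1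
    = P2 P1, and taking adjoints of the latter gives P1 = P1 P2. *)
Lemma hermsym_idem_inj n (P1 P2 : 'M[K]_n) :
  P1 \is hermsymmx -> P2 \is hermsymmx ->
  P1 *m P1 = P1 -> P2 *m P2 = P2 ->
  (forall u : 'rV_n, u *m P1 = 0 <-> u *m P2 = 0) -> P1 = P2.
Proof.
have gen (Q1 Q2 : 'M[K]_n) : Q1 *m Q1 = Q1 ->
    (forall u : 'rV_n, u *m Q1 = 0 -> u *m Q2 = 0) -> Q2 = Q1 *m Q2.
  move=> Q1Q1 ker; apply/eqP; rewrite -subr_eq0 -{1}[Q2]mul1mx -mulmxBl.
  apply/eqP/row_matrixP => i; rewrite row_mul row0; apply: ker.
  by rewrite -row_mul mulmxBl mul1mx Q1Q1 subrr row0.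
move=> /hermsymmxP H1 /hermsymmxP H2 I1 I2 ker.
rewrite {1}H1 (gen P2 P1 I2 (fun u => (ker u).2)) adjmxM -H1 -H2.
by rewrite -(gen P1 P2 I1 (fun u => (ker u).1)).
Qed.

Lemma hermsym_idem_psd n (Q : 'M[K]_n) :
  Q \is hermsymmx -> Q *m Q = Q -> psdmx Q.
Proof.
move=> QH QQ; split=> // u.
by rewrite -QQ mulmxA dotmx_mulr_hermsym // dotmx_ge0.
Qed.

End LinearAlgebra.

(** * Operators on a sub-region *)

Section Tensor.
Variables (K : numClosedFieldType) (V : finType) (d : nat) (S R : {set V}).
Hypothesis sub : S \subset R.

(** Inverse to the pair of restrictions to S and to its complement in R; this is the tensor
    splitting of the Hilbert space of R. The match on [boolP] supplies the membership proofs. *)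
Definition join (s : lab S d) (z : lab (R :\: S) d) : lab R d :=
  [ffun v : {v | v \in R} =>
    match @boolP (sval v \in S) with
    | AltTrue vS => s (exist _ (sval v) vS)
    | AltFalse vnS => z (exist _ (sval v)
        (introT setDP (conj (svalP v) vnS)))
    end].

Lemma lab_val (T : finType) (A : {set T}) (f : lab A d) t t' :
  sval t = sval t' -> f t = f t'.
Proof. by move=> tt'; congr (f _); apply: val_inj. Qed.

Lemma join_in s z (v : {v | v \in R}) (t : {v | v \in S}) :
  sval v = sval t -> join s z v = s t.
Proof.
move=> vt; rewrite ffunE; case: {-}_ / boolP => [vS | vnS].
  exact: lab_val.
by case/negP: vnS; rewrite vt (svalP t).
Qed.

Lemma join_out s z (v : {v | v \in R}) (t : {v | v \in R :\: S}) :
  sval v = sval t -> join s z v = z t.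
Proof.
move=> vt; rewrite ffunE; case: {-}_ / boolP => [vS | vnS].
  by have := svalP t; rewrite -vt inE vS.
exact: lab_val.
Qed.

Lemma res_join_in s z : res sub (join s z) = s.
Proof. by apply/ffunP => v; rewrite ffunE (@join_in _ _ _ v). Qed.

Lemma res_join_out s z : res (subsetDl R S) (join s z) = z.
Proof. by apply/ffunP => v; rewrite ffunE (@join_out _ _ _ v). Qed.

Lemma join_res x : join (res sub x) (res (subsetDl R S) x) = x.
Proof.
apply/ffunP => v; have [vS | vnS] := boolP (sval v \in S).
  by rewrite (@join_in _ _ _ (exist (fun w => w \in S) _ vS)) // ffunE; apply: lab_val.
have vRS : sval v \in R :\: S by rewrite inE vnS (svalP v).
by rewrite (@join_out _ _ _ (exist (fun w => w \in R :\: S) _ vRS)) // ffunE; apply: lab_val.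
Qed.

Lemma sum_join (F : lab R d -> K) : \sum_x F x = \sum_z \sum_s F (join s z).
Proof.
rewrite pair_big /= (reindex (fun p : lab (R :\: S) d * lab S d => join p.2 p.1)).
  by [].
exists (fun x => (res (subsetDl R S) x, res sub x)) => [[z s] _ | x _] /=.
  by rewrite res_join_in res_join_out.
exact: join_res.
Qed.

Lemma sum_enum_rank (X : finType) (F : 'I_#|X| -> K) :
  \sum_k F k = \sum_x F (enum_rank x).
Proof. by rewrite (reindex (@enum_rank X)) //; apply/onW_bij/enum_rank_bij. Qed.

(** The partial inner product of u with the basis vector z outside S: u is the sum over z of its
    slices tensored with z, and an operator on S acts slice by slice. *)
Definition slice (u : 'rV[K]_#|lab R d|) (z : lab (R :\: S) d) :
    'rV[K]_#|lab S d| :=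
  ket (fun s => u 0 (enum_rank (join s z))).

Lemma slice_tensor_id (M : 'M[K]_#|lab S d|) u z :
  slice (u *m tensor_id sub M) z = slice u z *m M.
Proof.
apply/rowP => k; rewrite !mxE !sum_enum_rank sum_join exchange_big /=.
apply: eq_bigr => s _; rewrite (bigD1 z) //= big1 ?addr0 => [|z' z'z];
  rewrite !mxE !enum_rankK !res_join_out.
  by rewrite eqxx !res_join_in enum_valK.
by rewrite (negPf z'z) mulr0.
Qed.

Lemma slice_inj u v : (forall z, slice u z = slice v z) -> u = v.
Proof.
move=> uv; apply/rowP => k; rewrite -(enum_valK k) -[enum_val k]join_res.
have /rowP/(_ (enum_rank (res sub (enum_val k)))) :=
  uv (res (subsetDl R S) (enum_val k)).
by rewrite !mxE enum_rankK.
Qed.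

Lemma dotmx_slice u v : dotmx u v = \sum_z dotmx (slice u z) (slice v z).
Proof.
rewrite dotmx_sum sum_enum_rank sum_join; apply: eq_bigr => z _.
rewrite dotmx_sum sum_enum_rank; apply: eq_bigr => s _.
by rewrite !mxE enum_rankK.
Qed.

Lemma tensor_id_eq0 (M : 'M[K]_#|lab S d|) u :
  u *m tensor_id sub M = 0 <-> forall z, slice u z *m M = 0.
Proof.
have slice0 z : slice 0 z = 0 by apply/rowP => k; rewrite !mxE.
split=> [u0 z | u0]; first by rewrite -slice_tensor_id u0 slice0.
by apply: slice_inj => z; rewrite slice_tensor_id u0 slice0.
Qed.

Lemma tensor_id_hermsym (M : 'M[K]_#|lab S d|) :
  M \is hermsymmx -> tensor_id sub M \is hermsymmx.
Proof.
move=> /hermsymmxP MH; apply/hermsymmxP/matrixP => i j.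
rewrite !mxE eq_sym; case: ifP => _; last by rewrite conjC0.
by rewrite {1}MH !mxE.
Qed.

Lemma tensor_id_psd (M : 'M[K]_#|lab S d|) :
  psdmx M -> psdmx (tensor_id sub M).
Proof.
move=> [MH M0]; split; first exact: tensor_id_hermsym.
move=> u; rewrite dotmx_slice sumr_ge0 // => z _.
by rewrite slice_tensor_id.
Qed.

Lemma tensor_id_idem (M : 'M[K]_#|lab S d|) :
  M *m M = M -> tensor_id sub M *m tensor_id sub M = tensor_id sub M.
Proof.
move=> MM; apply/row_matrixP => i; rewrite !rowE mulmxA.
by apply: slice_inj => z; rewrite !slice_tensor_id -mulmxA MM.
Qed.

End Tensor.

(** * PEPS of a classical model on a graph *)

Lemma ket_coord (K : Type) (X : finType) (u : 'rV[K]_#|X|) :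
  u = ket (fun x => u 0 (enum_rank x)).
Proof. by apply/rowP => k; rewrite mxE enum_valK. Qed.

(** * Matrix elements of tensor products of matrices *)

Section Kronecker.
Variables (K : comNzRingType) (I : finType) (d : nat).
Implicit Types (A B : I -> 'M[K]_d) (y z : {ffun I -> 'I_d}).

Definition kron A y z : K := \prod_i A i (y i) (z i).

Lemma kron_mul A B y z :
  \sum_a kron A y a * kron B a z = kron (fun i => A i *m B i) y z.
Proof.
transitivity (\sum_(a : {ffun I -> 'I_d}) \prod_i (A i (y i) (a i) * B i (a i) (z i))).
  by apply: eq_bigr => a _; rewrite -big_split.
rewrite -(bigA_distr_bigA (fun i k => A i (y i) k * B i k (z i))).
by apply: eq_bigr => i _; rewrite mxE.
Qed.

Lemma kron1 A y z : (forall i, A i = 1%:M) -> kron A y z = (y == z)%:R.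
Proof.
move=> A1; have [-> | yz] := eqVneq y z.
  by rewrite /kron big1 // => i _; rewrite A1 mxE eqxx.
have [i yzi] : exists i, y i != z i.
  by apply/existsP; apply: contra_neqT yz => /existsPn yz; apply/ffunP => i;
    apply/eqP/negPn/yz.
by rewrite /kron (bigD1 i) //= A1 mxE (negPf yzi) mul0r.
Qed.

End Kronecker.

(** Induction on the number of sites where x and y differ, correcting one site of x at a time. *)
Lemma eq_ffun_sitewise (I J : finType) (T : Type) (F : {ffun I -> J} -> T) :
  (forall i (x y : {ffun I -> J}), (forall j, j != i -> x j = y j) -> F x = F y) ->
  forall x y, F x = F y.
Proof.
move=> Floc x y; move: {2}#|_|.+1 (ltnSn #|[pred i | x i != y i]|) => n.
elim: n x => // n IHn x; rewrite ltnS => xy.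
have [i xyi | xyE] := pickP [pred i | x i != y i]; last first.
  by congr F; apply/ffunP => i; apply/eqP/negbFE/xyE.
pose x' : {ffun I -> J} := [ffun j => if j == i then y j else x j].
rewrite (Floc i x x') => [|j ji]; last by rewrite ffunE (negPf ji).
apply: IHn; apply: leq_trans xy; rewrite (cardD1 i [pred i | x i != y i]) (_ : i \in _) //.
rewrite add1n ltnS; apply/subset_leq_card/subsetP => j; rewrite !inE ffunE.
by case: (eqVneq j i) => [-> | _] //=; rewrite eqxx.
Qed.

Section Extension.
Variables (T : finType) (d : nat) (k0 : 'I_d).

(** Extending by the default [k0] lets spins be read at the ends of edges, and compared across
    regions, without membership proofs. *)
Definition ext (A : {set T}) (x : lab A d) (t : T) : 'I_d :=
  oapp x k0 (insub t).

Lemma ext_val (A : {set T}) (x : lab A d) (t : {t | t \in A}) :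
  ext x (sval t) = x t.
Proof. by rewrite /ext valK. Qed.

Lemma ext_res (A B : {set T}) (sub : A \subset B) (x : lab B d) t :
  t \in A -> ext (res sub x) t = ext x t.
Proof.
move=> tA; rewrite -[t]/(sval (exist (fun t => t \in A) t tA)) ext_val ffunE /=.
by rewrite -ext_val.
Qed.

Lemma eq_ext (A : {set T}) (x y : lab A d) : ext x =1 ext y -> x = y.
Proof. by move=> xy; apply/ffunP => t; rewrite -!ext_val. Qed.

Lemma ext_out (A : {set T}) (x : lab A d) t : t \notin A -> ext x t = k0.
Proof. by move=> tA; rewrite /ext insubN. Qed.

End Extension.

(** * The range of Gamma, non-injectivity, and the parent Hamiltonian on a loopless graph *)

Section ClassicalPeps.
Variables (R : realType) (V : finType) (E : {set V * V}) (d : nat).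
Variable phi : V * V -> V -> 'M[R[i]]_d.
Variable k0 : 'I_d.
Hypothesis loopless : forall e, e \in E -> e.1 != e.2.
Hypothesis phi_unit :
  forall e, e \in E -> phi e e.1 \in unitmx /\ phi e e.2 \in unitmx.
Hypothesis C_neq0 :
  forall (S : {set V}) (x : lab S d), inner_factor E phi x != 0.

Implicit Types (S T : {set V}) (e : V * V) (v : V).

Local Notation A := (classical_tensor E phi).
Local Notation C := (inner_factor E phi).

Definition bend S e : V := if e.1 \in S then e.1 else e.2.

Definition site_mx e v : 'M[R[i]]_d := \matrix_(x, k) site_amplitude phi e v x k.

(** Indexed by edges, not sites: a site with several boundary edges has its spin repeated, so [bd]
    need not be surjective. *)
Definition bd S (x : lab S d) : lab (boundary E S) d :=
  [ffun e : {e | e \in boundary E S} => ext k0 x (bend S (sval e))].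

Lemma site_mx_unit S e :
  e \in boundary E S -> site_mx e (bend S e) \in unitmx.
Proof.
rewrite inE => /andP[eE _]; have [u1 u2] := phi_unit eE.
rewrite /bend; case: ifP => _.
  suff -> : site_mx e e.1 = phi e e.1 by [].
  by apply/matrixP => x k; rewrite mxE /site_amplitude eqxx.
suff -> : site_mx e e.2 = map_mx Num.conj (phi e e.2) by rewrite map_unitmx.
apply/matrixP => x k; rewrite !mxE /site_amplitude.
by rewrite eq_sym (negPf (loopless eE)).
Qed.

Lemma inner_factorE S (x : lab S d) :
  C x = \prod_(e in inner E S)
    edge_amplitude phi e (ext k0 x e.1) (ext k0 x e.2).
Proof.
rewrite big_sub; apply: eq_bigr => e _.
by congr edge_amplitude; rewrite -(ext_val k0).
Qed.

Lemma site_amplitude_inner S e (f : V -> 'I_d) k : e \in inner E S ->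
  \prod_(v in S | e \in incident E v) site_amplitude phi e v (f v) k =
  phi e e.1 (f e.1) k * Num.conj (phi e e.2 (f e.2) k).
Proof.
rewrite inE => /and3P[eE e1 e2]; have e12 := loopless eE.
rewrite (bigD1 e.1) /=; last by rewrite e1 inE eE eqxx.
rewrite (bigD1 e.2) /=; last by rewrite e2 inE eE eqxx orbT eq_sym.
rewrite big1 ?mulr1 => [|v].
  by rewrite /site_amplitude eqxx [e.2 == _]eq_sym (negPf e12).
by rewrite inE eE /= -andbA => /and3P[/andP[_ /orP[] /eqP ->]]; rewrite eqxx.
Qed.

Lemma site_amplitude_boundary S e (f : V -> 'I_d) k : e \in boundary E S ->
  \prod_(v in S | e \in incident E v) site_amplitude phi e v (f v) k =
  site_mx e (bend S e) (f (bend S e)) k.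
Proof.
move=> eb; rewrite (big_pred1 (bend S e)) ?mxE // => v /=.
move: eb; rewrite !inE /bend => /andP[-> ] /=.
case: ifP => e1 /= e2.
  have [-> | ve1] := eqVneq v e.1; first by rewrite e1.
  apply/negP => /andP[vS /eqP ev].
  by rewrite ev vS in e2.
have [-> | ve2] := eqVneq v e.2; first by rewrite e2 orbT.
apply/negP => /andP[vS]; rewrite orbF => /eqP ev.
by rewrite ev vS in e1.
Qed.

Definition end_mx S (e : {e : V * V | e \in boundary E S}) : 'M[R[i]]_d :=
  site_mx (sval e) (bend S (sval e)).

(** Regrouping the site tensors edge by edge makes the summand a product over edges, so the sum over
    labellings becomes a product of sums: an inner edge yields its edge amplitude, a boundary edge
    one entry of an invertible matrix. *)
Lemma contract_classical S (alpha : lab (boundary E S) d) (x : lab S d) :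
  contract A alpha x =
  C x * kron (@end_mx S) (bd x) alpha.
Proof.
pose W e k : R[i] := \prod_(v in S | e \in incident E v)
  site_amplitude phi e v (ext k0 x v) k.
(* The constraint that the boundary indices equal [alpha] is absorbed as a vanishing factor, so that
   the sum over labellings is free and distributes. *)
pose W' e (k : 'I_d) : R[i] :=
  if (e \in boundary E S) && (k != ext k0 alpha e) then 0 else W e k.
have prodW (g : lab (touching E S) d) :
    \prod_(v : {v | v \in S}) A (sval v) (x v) (res (incident_touching E v) g) =
    \prod_(e : {e | e \in touching E S}) W (sval e) (g e).
  transitivity (\prod_(v in S) \prod_(e in incident E v)
      site_amplitude phi e v (ext k0 x v) (ext k0 g e)).
    rewrite [RHS]big_sub; apply: eq_bigr => v _.
    rewrite [RHS]big_sub; apply: eq_bigr => e _.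
    rewrite (ext_val k0 x v) -(ext_val k0 (res _ g)) ext_res //.
    exact: valP e.
  rewrite (exchange_big_dep [in touching E S]) /=.
    rewrite big_sub; apply: eq_bigr => e _.
    by apply: eq_bigr => v _; rewrite ext_val.
  move=> v e vS; apply: (subsetP (incident_touching E (exist _ v vS))).
transitivity (\sum_(g : lab (touching E S) d)
    \prod_(e : {e | e \in touching E S}) W' (sval e) (g e)).
  rewrite /contract big_mkcond; apply: eq_bigr => g _; rewrite prodW.
  case: (eqVneq (res (boundary_touching E S) g) alpha) => [ga | ga].
    apply: eq_bigr => e _; rewrite /W' -ga.
    case: (boolP (sval e \in boundary E S)) => //= eb.
    by rewrite ext_res // ext_val eqxx.
  have [e ge] : exists b : {b | b \in boundary E S},
      res (boundary_touching E S) g b != alpha b.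
    apply/existsP; apply: contra_neqT ga => /existsPn ga.
    by apply/ffunP => e; apply/eqP/negPn/ga.
  have et : sval e \in touching E S.
    exact: (subsetP (boundary_touching E S)) (svalP e).
  rewrite (bigD1 (exist (fun e => e \in touching E S) (sval e) et)) //=.
  rewrite {1}/W' (svalP e) -[g _](ext_val k0 g) /=.
  rewrite -(ext_res k0 (boundary_touching E S)) ?(svalP e) //.
  by rewrite !ext_val ge mul0r.
rewrite -(bigA_distr_bigA (fun (e : {e | e \in touching E S}) k => W' (sval e) k)).
transitivity (\prod_(e in touching E S) \sum_k W' e k); first by rewrite [RHS]big_sub.
rewrite (bigID [in inner E S]) /=; congr (_ * _).
  rewrite inner_factorE; apply: eq_big => [e | e /andP[_ ei]].
    by rewrite !inE; case: (e \in E) (e.1 \in S) (e.2 \in S) => [] [] [].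
  rewrite /edge_amplitude; apply: eq_bigr => k _; rewrite /W'.
  case: ifP => [/andP[eb _]|_]; last exact: site_amplitude_inner.
  by move: ei eb; rewrite !inE => /and3P[_ -> ->]; rewrite andbF.
transitivity (\prod_(e in boundary E S)
    site_mx e (bend S e) (ext k0 x (bend S e)) (ext k0 alpha e)); last first.
  by rewrite big_sub; apply: eq_bigr => e _; rewrite ffunE ext_val.
apply: eq_big => [e | e /andP[et ei]].
  by rewrite !inE; case: (e \in E) (e.1 \in S) (e.2 \in S) => [] [] [].
have eb : e \in boundary E S.
  move: et ei; rewrite !inE.
  by case: (e \in E) (e.1 \in S) (e.2 \in S) => [] [] [].
rewrite (bigD1 (ext k0 alpha e)) //= big1 => [|k ka].
  by rewrite addr0 /W' eqxx andbF; apply: site_amplitude_boundary.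
by rewrite /W' eb ka.
Qed.

(* Contracting the boundary indices with [dual_kron y] forces the boundary     *)
(* spins to be [y].                                                            *)
Definition dual_kron S (y alpha : lab (boundary E S) d) : R[i] :=
  kron (fun i => invmx (@end_mx S i)) alpha y.

Lemma dual_kronP S (y z : lab (boundary E S) d) :
  \sum_alpha kron (@end_mx S) z alpha
    * dual_kron y alpha = (z == y)%:R.
Proof.
rewrite kron_mul kron1 // => e; apply: mulmxV.
exact: site_mx_unit (valP e).
Qed.

Lemma mul_ket_Gamma S (w : lab (boundary E S) d -> R[i]) (x : lab S d) :
  (ket w *m Gamma A S) 0 (enum_rank x) =
  C x * \sum_alpha w alpha *
    kron (@end_mx S) (bd x) alpha.
Proof.
rewrite mxE sum_enum_rank mulr_sumr; apply: eq_bigr => alpha _.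
by rewrite !mxE !enum_rankK contract_classical mulrCA.
Qed.

(** The condition is u/C being a function of [bd], cross-multiplied. Conversely, such a function f
    is realised by superposing the vectors [dual_kron y] with weights f y. *)
Lemma mem_GP S (u : 'rV[R[i]]_#|lab S d|) :
  (u <= G A S)%MS <-> forall x y : lab S d, bd x = bd y ->
    u 0 (enum_rank x) * C y = u 0 (enum_rank y) * C x.
Proof.
rewrite /G genmxE; split=> [/submxP[w ->] x y xy | uxy].
  by rewrite [w]ket_coord !mul_ket_Gamma xy mulrAC [C x * C y]mulrC mulrAC.
(* The value 0 is for boundary labels that come from no configuration. *)
pose f y := if [pick x : lab S d | bd x == y] is Some x
  then u 0 (enum_rank x) / C x else 0.
apply/submxP; exists (ket (fun alpha => \sum_y f y * dual_kron y alpha)).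
apply/rowP => k; rewrite -(enum_valK k); move: (enum_val k) => x.
rewrite mul_ket_Gamma.
under eq_bigr do rewrite mulr_suml.
have dualE y : \sum_a f y * dual_kron y a * kron (@end_mx S) (bd x) a =
    f y * (bd x == y)%:R.
  rewrite -dual_kronP mulr_sumr; apply: eq_bigr => a _.
  by rewrite -mulrA [dual_kron _ _ * _]mulrC.
rewrite exchange_big /= (bigD1 (bd x)) //= dualE big1 => [|y yx]; last first.
  by rewrite dualE eq_sym (negPf yx) mulr0.
rewrite eqxx mulr1 addr0 /f.
case: pickP => [x' /eqP xx' | /(_ x)]; last by rewrite eqxx.
apply: (mulIf (C_neq0 x')); rewrite (uxy _ _ (esym xx')).
by rewrite mulrA divfK // mulrC.
Qed.

(** Both edges read the same spin, so a label y differing on them is never of the form [bd x]; then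
    [dual_kron y] is killed by Gamma, yet it is nonzero because it pairs to 1 with the Kronecker row
    of y. *)
Lemma not_injective_region S e1 e2 : (1 < d)%N ->
  e1 \in boundary E S -> e2 \in boundary E S -> e1 != e2 ->
  bend S e1 = bend S e2 -> ~ injective_region A S.
Proof.
move=> d1 b1 b2 e12 be [_ inj].
have d0 : (0 < d)%N by apply: ltn_trans d1.
pose y : lab (boundary E S) d :=
  [ffun e => if sval e == e1 then Ordinal d0 else Ordinal d1].
have w0 : ket (dual_kron y) = 0.
  apply: inj; rewrite mul0mx; apply/rowP => k; rewrite -(enum_valK k).
  rewrite mul_ket_Gamma [RHS]mxE; under eq_bigr do rewrite mulrC.
  rewrite dual_kronP; case: eqVneq => [by0 | _]; last by rewrite mulr0.
  have y1 := congr1 (fun z : lab _ d => z (exist (fun e => e \in _) e1 b1)) by0.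
  have y2 := congr1 (fun z : lab _ d => z (exist (fun e => e \in _) e2 b2)) by0.
  move: y1 y2; rewrite !ffunE /= be => ->.
  by rewrite eqxx eq_sym (negPf e12) => /(congr1 val).
have := dual_kronP y y; rewrite eqxx big1 => [/eqP | alpha _].
  by rewrite eq_sym oner_eq0.
have /rowP/(_ (enum_rank alpha)) := w0; rewrite !mxE enum_rankK => ->.
by rewrite mulr0.
Qed.

Lemma eq_bdP S (x y : lab S d) :
  (forall e, e \in boundary E S -> ext k0 x (bend S e) = ext k0 y (bend S e)) ->
  bd x = bd y.
Proof. by move=> xy; apply/ffunP => e; rewrite !ffunE; apply: xy (valP e). Qed.

Lemma bd_ext S (x y : lab S d) e : bd x = bd y ->
  e \in boundary E S -> ext k0 x (bend S e) = ext k0 y (bend S e).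
Proof.
move=> xy eb.
have := congr1 (fun z : lab _ d => z (exist (fun e => e \in _) e eb)) xy.
by rewrite !ffunE.
Qed.

(* The edges of T outside S only see boundary sites of S and sites outside S. *)
Lemma inner_factor_ratio S T (sub : S \subset T) (x y : lab T d) :
  bd (res sub x) = bd (res sub y) ->
  (forall v, v \notin S -> ext k0 x v = ext k0 y v) ->
  C x * C (res sub y) = C y * C (res sub x).
Proof.
move=> xyb xyo; rewrite !inner_factorE.
have innerS (z : lab T d) :
    \prod_(e in inner E S) edge_amplitude phi e (ext k0 (res sub z) e.1)
      (ext k0 (res sub z) e.2) =
    \prod_(e in inner E T | e \in inner E S)
      edge_amplitude phi e (ext k0 z e.1) (ext k0 z e.2).
  apply: eq_big => [e | e]; rewrite !inE.
    by case: (e \in E) => //=; apply/idP/idP => [/andP[e1 e2]|/andP[_] //];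
      rewrite !(subsetP sub) ?e1 ?e2.
  by case/and3P=> _ e1 e2; rewrite !ext_res.
rewrite !innerS [X in X * _](bigID [in inner E S]) /=.
rewrite [X in _ = X * _](bigID [in inner E S]) /=.
rewrite mulrAC [RHS]mulrAC; congr (_ * _); first by rewrite mulrC.
apply: eq_bigr => e; rewrite !inE => /andP[/and3P[eE _ _]].
rewrite eE /= negb_and => eS.
(* If the end v lies in S then v' does not, so the edge is a boundary edge with inner end v. *)
have eq_site v v' : e = (v, v') \/ e = (v', v) -> ext k0 x v = ext k0 y v.
  move=> evv; have [vS | /xyo //] := boolP (v \in S).
  have v'S : v' \notin S.
    by case: evv eS => -> /=; rewrite vS ?orbF.
  have eb : e \in boundary E S.
    by rewrite inE eE; case: evv => -> /=; rewrite vS (negPf v'S).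
  have ve : bend S e = v.
    by rewrite /bend; case: evv => -> /=; rewrite ?vS ?(negPf v'S).
  by have := bd_ext xyb eb; rewrite ve !ext_res.
by rewrite (eq_site e.1 e.2) 1?(eq_site e.2 e.1) //; [right | left]; case: (e).
Qed.

(** A site whose neighbours all lie in S is the inner end of no boundary edge. *)
Lemma bd_interior S (v : V) (x y : lab S d) :
  (forall w, adj E v w -> w \in S) -> v \in S ->
  (forall w, w != v -> ext k0 x w = ext k0 y w) -> bd x = bd y.
Proof.
move=> vS' vS xy; apply: eq_bdP => e eb; apply: xy.
apply: contraTneq eb => be; rewrite inE; apply/nandP.
have [eE | ] := boolP (e \in E); last by left.
right; have e12 : (e.1, e.2) \in E by case: (e) eE.
move: be; rewrite /bend; case: ifP => e1 ev; subst v.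
  by rewrite (vS' e.2) // /adj e12.
by rewrite (vS' e.1) ?vS // /adj e12 orbT in e1.
Qed.

Lemma P_hermsym S : P A S \is hermsymmx.
Proof. exact: proj_ortho_hermsym. Qed.

Lemma P_idem S : P A S *m P A S = P A S.
Proof. exact: proj_ortho_proj. Qed.

Lemma mulmx_P_eq0 S n (W : 'M[R[i]]_(n, #|lab S d|)) :
  (W *m P A S == 0) = (W <= G A S)%MS.
Proof. exact: kermx_proj_ortho_orthomx. Qed.

Lemma P_parent_term S : parent_term A (P A S).
Proof.
split; first exact: hermsym_idem_psd (P_hermsym S) (P_idem S).
apply/andP; split; first by rewrite -mulmx_P_eq0 mulmx_ker.
by apply/sub_kermxP/eqP; rewrite mulmx_P_eq0.
Qed.

Lemma join_ext_in S T (s : lab S d) (z : lab (T :\: S) d) v :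
  S \subset T -> v \in S -> ext k0 (join s z) v = ext k0 s v.
Proof.
move=> sub vS; have vT := subsetP sub v vS.
rewrite -[v]/(sval (exist (fun v => v \in T) v vT)) ext_val.
by rewrite (@join_in _ _ _ _ _ _ _ (exist (fun v => v \in S) v vS)) // -(ext_val k0).
Qed.

Lemma join_ext_out S T (s s' : lab S d) (z : lab (T :\: S) d) v :
  v \notin S -> ext k0 (join s z) v = ext k0 (join s' z) v.
Proof.
move=> vS; have [vT | vT] := boolP (v \in T); last by rewrite !ext_out.
have vTS : v \in T :\: S by rewrite inE vS.
rewrite -[v]/(sval (exist (fun v => v \in T) v vT)) !ext_val.
by rewrite !(@join_out _ _ _ _ _ _ _ (exist (fun v => v \in T :\: S) v vTS)).
Qed.

Lemma slice_sub_G S T (sub : S \subset T) (u : 'rV[R[i]]_#|lab T d|)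
    (z : lab (T :\: S) d) :
  (forall s s' : lab S d, bd s = bd s' ->
     u 0 (enum_rank (join s z)) * C (join s' z) =
     u 0 (enum_rank (join s' z)) * C (join s z)) ->
  (slice u z <= G A S)%MS.
Proof.
move=> uC; apply/mem_GP => s s' ss'; rewrite !mxE !enum_rankK.
have CC : C (join s z) * C s' = C (join s' z) * C s.
  have := @inner_factor_ratio S T sub (join s z) (join s' z).
  by rewrite !res_join_in; apply=> // w; apply: join_ext_out.
apply: (mulIf (C_neq0 (join s' z))).
by rewrite mulrAC uC // -!mulrA CC [C (join s' z) * _]mulrC.
Qed.

(** Since v is interior to S, x and y belong to the same slice and have the same boundary spins on
    S; [mem_GP] and [inner_factor_ratio] then say that u/C ignores the spin at v. *)
Lemma eq_off_site_G S T (sub : S \subset T) (v : V)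
    (u : 'rV[R[i]]_#|lab T d|) (x y : lab T d) :
  v \in S -> (forall w, adj E v w -> w \in S) ->
  (forall z, slice u z <= G A S)%MS ->
  (forall w, w != v -> ext k0 x w = ext k0 y w) ->
  u 0 (enum_rank x) * C y = u 0 (enum_rank y) * C x.
Proof.
move=> vS vadj uS xyv.
have rxy : bd (res sub x) = bd (res sub y).
  apply: (bd_interior vadj vS) => w wv.
  have [wS | wS] := boolP (w \in S); last by rewrite !ext_out.
  by rewrite !ext_res // xyv.
have oxy : res (subsetDl T S) x = res (subsetDl T S) y.
  apply: (@eq_ext _ _ k0) => w.
  have [wT | wT] := boolP (w \in T :\: S); last by rewrite !ext_out.
  rewrite !ext_res // xyv //; apply: contraTneq wT => ->.
  by rewrite inE vS.
have /mem_GP/(_ _ _ rxy) := uS (res (subsetDl T S) x).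
rewrite !mxE !enum_rankK join_res oxy join_res => uC.
have CC : C x * C (res sub y) = C y * C (res sub x).
  apply: inner_factor_ratio rxy _ => w wS; apply: xyv.
  by apply: contraNneq wS => ->.
apply: (mulIf (C_neq0 (res sub y))).
by rewrite mulrAC uC -!mulrA CC [C y * _]mulrC.
Qed.

(* Both sides are orthogonal projections, and in both kernels the only       *)
(* constraint concerns the dependence on the spin at [v].                    *)
Lemma P_tensor_id S T (sub : S \subset T) (v : V) :
  v \in S -> (forall w, adj E v w -> w \in S) ->
  (forall w, w \in T -> w != v ->
     exists2 e, e \in boundary E T & bend T e = w) ->
  (forall w, w \in S -> w != v ->
     exists2 e, e \in boundary E S & bend S e = w) ->
  P A T = tensor_id sub (P A S).
Proof.
move=> vS vadj bT bS; have vT := subsetP sub v vS.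
(* If every site of U other than v has a boundary edge, [bd] determines all spins except possibly
   the one at v. *)
have off U (x y : lab U d) : (forall w, w \in U -> w != v ->
     exists2 e, e \in boundary E U & bend U e = w) -> bd x = bd y ->
     forall w, w != v -> ext k0 x w = ext k0 y w.
  move=> bU xy w wv; have [wU | wU] := boolP (w \in U); last by rewrite !ext_out.
  by have [e eb <-] := bU w wU wv; apply: bd_ext.
apply: hermsym_idem_inj (P_idem T) _ _; first exact: P_hermsym.
- exact/tensor_id_hermsym/P_hermsym.
- exact/tensor_id_idem/P_idem.
move=> u; rewrite tensor_id_eq0; split=> [/eqP | uS].
  rewrite mulmx_P_eq0 => /mem_GP uT z; apply/eqP; rewrite mulmx_P_eq0.
  apply: slice_sub_G => // s s' ss'; apply: uT.
  apply: (bd_interior (fun w vw => subsetP sub w (vadj w vw)) vT) => w wv.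
  have [wS | wS] := boolP (w \in S); last exact: join_ext_out.
  by rewrite !join_ext_in // (off _ _ _ bS ss').
apply/eqP; rewrite mulmx_P_eq0; apply/mem_GP => x y xy.
apply: (eq_off_site_G sub vS vadj) (off _ _ _ bT xy) => z.
by rewrite -mulmx_P_eq0 uS.
Qed.

(** The Hamiltonian is frustration free: psi has energy 0 and all terms are positive, so a ground
    state is annihilated by each term. As each [Rv v] contains v and its neighbours, its ratio to C
    ignores every single spin and is constant. *)
Lemma unique_ground_state_parent (Rv : V -> {set V}) H (c : R[i]) :
  c != 0 -> (forall v, v \in Rv v) ->
  (forall v w, adj E v w -> w \in Rv v) ->
  parent_hamiltonian A Rv H ->
  unique_ground_state H (ket (fun x : lab [set: V] d => c * C x)).
Proof.
move=> c0 vRv adjRv [h [hP ->]]; set psi := ket _.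
have psiE x : psi 0 (enum_rank x) = c * C x by rewrite mxE enum_rankK.
have kerh v n (W : 'M_(n, _)) : (W *m h v == 0) = (W <= G A (Rv v))%MS.
  have [_ /andP[kG Gk]] := hP v; rewrite (sameP eqP sub_kermxP).
  by apply/idP/idP => /submx_trans; apply.
pose T v := tensor_id (subsetT (Rv v)) (h v).
have Tpsd v : psdmx (T v) by apply: tensor_id_psd; case: (hP v).
have dotH u : dotmx (u *m sum_local h) u = \sum_v dotmx (u *m T v) u.
  rewrite dotmxE mulmx_sumr mulmx_suml summxE.
  by apply: eq_bigr => v _; rewrite dotmxE.
have psi_neq0 : psi != 0.
  apply/eqP => /rowP/(_ (enum_rank [ffun => k0])).
  by rewrite psiE mxE => /eqP; rewrite mulf_eq0 (negPf c0) (negPf (C_neq0 _)).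
have psiH : psi *m sum_local h = 0.
  rewrite mulmx_sumr big1 // => v _; apply/tensor_id_eq0 => z.
  apply/eqP; rewrite kerh; apply: slice_sub_G => [|s s' _]; first exact: subsetT.
  by rewrite !psiE -!mulrA [C _ * _]mulrC.
have eig_ge0 E0 : eigenvalue (sum_local h) E0 -> 0 <= E0.
  case/eigenvalueP => u uE u0.
  have : 0 <= dotmx (u *m sum_local h) u.
    by rewrite dotH sumr_ge0 // => v _; case: (Tpsd v).
  rewrite uE dotmxE -scalemxAl mxE -dotmxE.
  by rewrite pmulr_lge0 // dotmx_gt0.
split; first by split=> //; exists 0; rewrite scale0r.
move=> w [w0 [E0 [wE Emin]]].
have {E0 wE Emin} wH : w *m sum_local h = 0.
  (* E0 is at most 0, the eigenvalue of psi, and at least 0 by positivity. *)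
  suff E00 : E0 = 0 by rewrite wE E00 scale0r.
  apply/le_anti; rewrite eig_ge0 ?Emin //; apply/eigenvalueP.
    by exists psi; rewrite ?scale0r.
  by exists w.
have wG v z : (slice w z <= G A (Rv v))%MS.
  rewrite -kerh; apply/eqP; move: z; apply/(tensor_id_eq0 (subsetT (Rv v))).
  apply: (psdmx_dot_eq0 (Tpsd v)).
  have : \sum_v dotmx (w *m T v) w = 0 by rewrite -dotH wH dotmxE mul0mx mxE.
  move/psumr_eq0P => -> // v' _; by case: (Tpsd v').
pose g (x : lab [set: V] d) := w 0 (enum_rank x) / C x.
have gconst : forall x y, g x = g y.
  apply: eq_ffun_sitewise => i x y xy.
  have xyv t : t != sval i -> ext k0 x t = ext k0 y t.
    move=> ti; have tT : t \in [set: V] by rewrite inE.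
    by rewrite -[t]/(sval (exist (fun t => t \in [set: V]) t tT)) !ext_val xy.
  have := eq_off_site_G (subsetT (Rv (sval i))) (vRv _) (adjRv _) (wG _) xyv.
  by rewrite /g => wxy; apply/eqP; rewrite eqr_div ?C_neq0 // wxy.
exists (g [ffun => k0] / c); apply/rowP => k; rewrite -(enum_valK k).
rewrite mxE psiE mulrA divfK // (gconst _ (enum_val k)) /g divfK //.
Qed.

End ClassicalPeps.

(** * The classical state as a multiple of C on the whole graph *)

Section Boltzmann.
Variables (R : realType) (V : finType) (E : {set V * V}) (d : nat).
Variables (h : 'I_d -> 'I_d -> R) (beta : R).
Variable phi : V * V -> V -> 'M[R[i]]_d.

Lemma partition_function_gt0 : (0 < d)%N -> 0 < partition_function E h beta.
Proof.
move=> d0; rewrite /partition_function.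
rewrite (bigD1 [ffun => Ordinal d0]) //= ltr_wpDr ?expR_gt0 //.
by apply: sumr_ge0 => x _; apply: expR_ge0.
Qed.

Lemma classical_stateE : boltzmann_decomposition E h beta phi ->
  classical_state E h beta =
  ket (fun x => (Num.sqrt (partition_function E h beta))^-1%:C%C
                * inner_factor E phi x).
Proof.
move=> hphi; apply/rowP => k; rewrite !mxE; move: (enum_val k) => x.
rewrite mulrC rmorphM /=; congr (_ * _).
rewrite /Hcl mulr_sumr -sumrN expR_sum rmorph_prod /=.
transitivity (\prod_(e in inner E [set: V])
    edge_amplitude phi e (x (exist _ e.1 (in_setT e.1)))
      (x (exist _ e.2 (in_setT e.2)))).
  by apply: eq_big => [e | e eE]; rewrite ?inE ?andbT // -hphi.
rewrite big_sub; apply: eq_bigr => e _.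
by congr edge_amplitude; apply: lab_val.
Qed.

End Boltzmann.

(** * The square lattice *)

Lemma boundary_adj (V : finType) (E : {set V * V}) (S : {set V}) (u w : V) :
  adj E w u -> w \in S -> u \notin S ->
  exists e, [/\ e \in boundary E S, bend S e = w & e = (w, u) \/ e = (u, w)].
Proof.
rewrite /adj => /orP[] eE wS uS; [exists (w, u) | exists (u, w)].
  by rewrite inE eE /bend /= wS (negPf uS); split=> //; left.
by rewrite inE eE /bend /= wS (negPf uS); split=> //; right.
Qed.

(** * Neighbours in one direction, on an open or periodic chain *)

Section Chain.
Variables (p : bool) (L : nat).

Definition nb (i j : 'I_L) : bool := succ_ord p i j || succ_ord p j i.

Lemma nearE i j : near p i j = (i == j) || nb i j.
Proof. by rewrite /near /nb. Qed.

Lemma card_nb i : (#|[set j | nb i j]| <= 2)%N.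
Proof.
have -> : [set j | nb i j] = [set j | succ_ord p i j] :|: [set j | succ_ord p j i].
  by apply/setP => j; rewrite !inE.
apply: leq_trans (leq_card_setU _ _) _; rewrite -[2%N]/(1 + 1)%N.
apply: leq_add; apply/card_le1_eqP => j k; rewrite !inE /succ_ord => ij ik;
  apply: val_inj => /=; move: ij ik;
  have := ltn_ord i; have := ltn_ord j; have := ltn_ord k; case: p => /=; lia.
Qed.

Definition ord_dist (i j : 'I_L) : nat := ((i - j) + (j - i))%N.

(** One step towards j inside the chain, never wrapping around; [ord_dist] is the absolute
    difference, written with truncated subtraction. *)
Lemma nb_closer (i j : 'I_L) :
  i != j -> exists2 k, nb i k & (ord_dist k j < ord_dist i j)%N.
Proof.
move=> ij; have := ltn_ord i; have := ltn_ord j => jL iL.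
have [lt_ij | le_ji] := ltnP i j.
  have kL : (i.+1 < L)%N by lia.
  exists (Ordinal kL); rewrite /nb /succ_ord /ord_dist /= ?eqxx //; lia.
have kL : (i.-1 < L)%N by lia.
have lt_ji : (j < i)%N.
  by rewrite ltn_neqAle le_ji andbT; apply: contra_neq ij => /val_inj.
exists (Ordinal kL); rewrite /nb /succ_ord /ord_dist /=; last by lia.
by apply/orP; right; rewrite prednK ?eqxx //; lia.
Qed.

Hypothesis L2 : (2 < L)%N.

Lemma succ_ord_irr (i : 'I_L) : succ_ord p i i = false.
Proof. by rewrite /succ_ord; case: p; have := ltn_ord i; lia. Qed.

Hypothesis pL : p -> (3 < L)%N.

(** An open chain has no cycles, and a periodic one is a single cycle of length at least 4. *)
Lemma nb_triangle i j k : nb i j -> nb j k -> nb i k -> False.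
Proof.
have := pL; have := ltn_ord i; have := ltn_ord j; have := ltn_ord k.
by rewrite /nb /succ_ord; case: p => /=; lia.
Qed.

End Chain.

(** * Sites with edges leaving a region of the lattice *)

Section SquareLattice.
Variables (px py : bool) (m n : nat).
Hypotheses (m2 : (2 < m)%N) (n2 : (2 < n)%N).
Hypotheses (pxm : px -> (3 < m)%N) (pyn : py -> (3 < n)%N).

Local Notation E := (lattice px py m n).
Implicit Types (u v w : site m n).

Lemma lattice_loopless e : e \in E -> e.1 != e.2.
Proof.
case: e => u w; rewrite inE /=; apply: contraTneq => ->.
by rewrite !succ_ord_irr //= ?andbF.
Qed.

Lemma adj_latticeE u w :
  adj E u w = nb px u.1 w.1 && (u.2 == w.2) || (u.1 == w.1) && nb py u.2 w.2.
Proof.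
rewrite /adj !inE /= /nb [w.2 == _]eq_sym [w.1 == _]eq_sym.
by case: (u.2 == w.2); case: (u.1 == w.1);
  rewrite /= ?andbT ?andbF ?orbF //; case: (succ_ord px u.1 w.1);
  case: (succ_ord px w.1 u.1); case: (succ_ord py u.2 w.2).
Qed.

Lemma blockE v w :
  (w \in block px py v) = ((v.1 == w.1) || nb px v.1 w.1)
                          && ((v.2 == w.2) || nb py v.2 w.2).
Proof. by rewrite inE !nearE. Qed.

Lemma mem_cross v : v \in cross px py v.
Proof. by rewrite inE eqxx. Qed.

Lemma adj_cross v w : adj E v w -> w \in cross px py v.
Proof. by rewrite inE => ->; rewrite orbT. Qed.

Lemma nbs_sub w :
  [set u | adj E w u] \subset
    [set (a, w.2) | a in [set a | nb px w.1 a]]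
    :|: [set (w.1, b) | b in [set b | nb py w.2 b]].
Proof.
apply/subsetP => -[a b]; rewrite inE adj_latticeE /= in_setU.
case/orP => /andP[]; first by
  move=> ha /eqP <-; apply/orP; left; apply/imsetP; exists a; rewrite ?inE.
by move=> /eqP <- hb; apply/orP; right; apply/imsetP; exists b; rewrite ?inE.
Qed.

(** Each direction contributes at most two neighbours, so four of them force two in each. *)
Lemma two_nbs w : #|[set u | adj E w u]| = 4%N ->
  #|[set a | nb px w.1 a]| = 2%N /\ #|[set b | nb py w.2 b]| = 2%N.
Proof.
move=> w4; have le4 : (4 <= #|[set a | nb px w.1 a]| + #|[set b | nb py w.2 b]|)%N.
  rewrite -w4; apply: leq_trans (subset_leq_card (nbs_sub w)) _.
  by apply: leq_trans (leq_card_setU _ _) _; apply: leq_add; apply: leq_imset_card.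
have aux (x y : nat) :
  (4 <= x + y -> x <= 2 -> y <= 2 -> x = 2%N /\ y = 2%N)%N by lia.
by apply: aux le4 _ _; apply: card_nb.
Qed.

Lemma other_nb (p : bool) (L : nat) (i j : 'I_L) :
  #|[set a | nb p i a]| = 2%N -> exists2 k, nb p i k & k != j.
Proof.
move=> i2; have : (0 < #|[set a | nb p i a] :\ j|)%N.
  by have := cardsD1 j [set a | nb p i a]; rewrite i2; case: (_ \in _); lia.
by case/card_gt0P => k; rewrite !inE => /andP[kj ik]; exists k.
Qed.

(** In a coordinate where w differs from v, move w to its neighbour other than v there. Still being
    next to v would create a triangle, so the move leaves the block. *)
Lemma block_exit v w : bulk px py v -> w \in block px py v -> w != v ->
  exists2 u, adj E w u & u \notin block px py v.
Proof.
move=> bv wb wv; have [x2 y2] := two_nbs (bv w wb).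
move: wb; rewrite blockE => /andP[wb1 wb2].
have [e1 | n1] := eqVneq v.1 w.1.
  have n2' : v.2 != w.2.
    by apply: contra_neq wv => e2; rewrite [LHS]surjective_pairing -e1 -e2 -surjective_pairing.
  have [k wk kv] := other_nb v.2 y2; exists (w.1, k).
    by rewrite adj_latticeE /= eqxx wk orbT.
  rewrite blockE /= negb_and; apply/orP; right; rewrite eq_sym (negPf kv) /=.
  apply/negP => vk; move: wb2; rewrite (negPf n2') /= => vw.
  exact: (nb_triangle n2 pyn vw wk vk).
have [k wk kv] := other_nb v.1 x2; exists (k, w.2).
  by rewrite adj_latticeE /= eqxx wk.
rewrite blockE /= negb_and; apply/orP; left; rewrite eq_sym (negPf kv) /=.
apply/negP => vk; move: wb1; rewrite (negPf n1) /= => vw.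
exact: (nb_triangle m2 pxm vw wk vk).
Qed.

(* Take the site of [S] closest to an avoided row and an avoided column. *)
Lemma two_exits (S : {set site m n}) i j : S != set0 ->
  (forall v, v \in S -> v.1 != i) -> (forall v, v \in S -> v.2 != j) ->
  exists e1 e2, [/\ e1 \in boundary E S, e2 \in boundary E S, e1 != e2
    & bend S e1 = bend S e2].
Proof.
case/set0Pn => v0 v0S Si Sj.
case: (arg_minnP (fun v => ord_dist v.1 i + ord_dist v.2 j)%N v0S) => v vS vmin.
have [a va da] := nb_closer px (Si v vS).
have [b vb db] := nb_closer py (Sj v vS).
have aS : (a, v.2) \notin S.
  by apply/negP => /vmin; rewrite leq_add2r leqNgt da.
have bS : (v.1, b) \notin S.
  by apply/negP => /vmin; rewrite leq_add2l leqNgt db.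
have av : a != v.1 by apply: contraTneq da => ->; rewrite ltnn.
have adja : adj E v (a, v.2) by rewrite adj_latticeE /= va eqxx.
have adjb : adj E v (v.1, b) by rewrite adj_latticeE /= vb eqxx orbT.
have [e1 [b1 v1 e1E]] := boundary_adj adja vS aS.
have [e2 [b2 v2 e2E]] := boundary_adj adjb vS bS.
exists e1, e2; split=> //; last by rewrite v1 v2.
(* Were the edges equal, comparing first coordinates would give a = v.1 for every choice of
   orientations. *)
apply/eqP => e12; move: av; apply/negP/negPn/eqP; move: e12.
case: e1E => ->; case: e2E => -> e12.
- exact: (congr1 (fun e => e.2.1) e12).
- exact: (congr1 (fun e => e.2.1) e12).
- exact: (congr1 (fun e => e.1.1) e12).
- exact: (congr1 (fun e => e.1.1) e12).
Qed.

End SquareLattice.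

Theorem mainTheorem4 (R : realType) (d m n : nat) (px py : bool)
  (h : 'I_d -> 'I_d -> R) (beta : R)
  (phi : site m n * site m n -> site m n -> 'M[R[i]]_d)
  (hd : (1 < d)%N)
  (hm : (2 < m)%N) (hn : (2 < n)%N)
  (hmp : px -> (3 < m)%N) (hnp : py -> (3 < n)%N)
  (hphi : boltzmann_decomposition (lattice px py m n) h beta phi)
  (hinv : forall e, e \in lattice px py m n ->
     phi e e.1 \in unitmx /\ phi e e.2 \in unitmx)
  (hC : forall (S : {set site m n}) (x : lab S d),
     inner_factor (lattice px py m n) phi x != 0) :
  let A := classical_tensor (lattice px py m n) phi in
  let psi := classical_state (lattice px py m n) h beta in
  [/\ ~ injective_peps A (@proper_covering m n),
      (forall (Rv : site m n -> {set site m n})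
              (H : 'M[R[i]]_#|lab [set: site m n] d|),
         (forall v, Rv v = block px py v \/ Rv v = cross px py v) ->
         parent_hamiltonian A Rv H -> unique_ground_state H psi),
      (forall v : site m n, bulk px py v ->
         P A (block px py v)
         = tensor_id (cross_block px py v) (P A (cross px py v))) &
      (forall Rv : site m n -> {set site m n},
         (forall v, Rv v = block px py v \/ Rv v = cross px py v) ->
         parent_hamiltonian A Rv (sum_local (fun v => P A (Rv v))))].
Proof.
move=> A psi; have d0 : (0 < d)%N by apply: ltn_trans hd.
pose k0 := Ordinal d0; have loopless := @lattice_loopless px py m n hm hn.
split.
- case=> cov [part proper inj].
  have [S Scov] : exists S, S \in cov.
    apply/set0Pn/eqP => cov0; have := cover_partition part.
    rewrite cov0 /cover big_set0 => /setP/(_ (Ordinal (ltnW (ltnW hm)), Ordinal (ltnW (ltnW hn)))).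
    by rewrite !inE.
  have [[i Si] [j Sj]] := proper S Scov; have injS := inj S Scov.
  have [[S0 _] _] := injS.
  have [e1 [e2 [b1 b2 e12 be]]] := @two_exits px py m n S i j S0 Si Sj.
  by case: (not_injective_region k0 loopless hinv hd b1 b2 e12 be injS).
- move=> Rv H RvE HP; rewrite /psi (classical_stateE hphi).
  (* Uniqueness only uses that each region contains the cross. *)
  have cross_Rv v : cross px py v \subset Rv v.
    by case: (RvE v) => -> //; apply: cross_block.
  apply: (unique_ground_state_parent k0 loopless hinv hC) HP => [|v|v w vw].
  + rewrite (fmorph_eq0 (real_complex R)) invr_eq0 gt_eqF // sqrtr_gt0.
    exact: partition_function_gt0.
  + exact: subsetP (cross_Rv v) _ (mem_cross _ _ _).
  + exact: subsetP (cross_Rv v) _ (adj_cross vw).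
(* Stated for subsets of the block so as to serve block and cross alike: a neighbour outside the
   block is also outside S. *)
- move=> v bv; have exit (S : {set site m n}) w : S \subset block px py v -> w \in S -> w != v ->
      exists2 e, e \in boundary (lattice px py m n) S & bend S e = w.
    move=> Sb wS wv.
    have [u wu ub] := block_exit hm hn hmp hnp bv (subsetP Sb w wS) wv.
    have [|e [eb ew _]] := boundary_adj wu wS; last by exists e.
    exact: contra (subsetP Sb u) ub.
  apply: (P_tensor_id k0 loopless hinv hC (cross_block px py v) (mem_cross px py v)) => w.
  + exact: adj_cross.
  + exact: exit.
  + by apply: exit; apply: cross_block.
- move=> Rv _; exists (fun v => P A (Rv v)); split=> // v.
  exact: P_parent_term.
Qed.
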